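(* Let $\lambda>0$ be arbitrary and suppose that the simultaneous Doeblin condition holds: there exist a state $z\in S$ and $M\in(0,\infty)$ such that $E_x^f[T]\le M$ for all $x\in S$ and $f\in\mathbb{F}$, where $T:=\min\{n>0\mid X_n=z\}$. Then, for each $x\in S$, $$J^*(\lambda,x)=\inf_{g\in\mathcal{G}} g(x).$$
   Context: Decision model. $S$ (state space) and $A$ (action space) are nonempty finite sets; for each $x\in S$, $A(x)\subset A$ is a nonempty set of admissible actions; $\mathbb{K}:=\{(x,a)\mid a\in A(x),\,x\in S\}$. $C:\mathbb{K}\to\mathbb{R}$ is the one-step cost function, and $p_{xy}(a)$, for $(x,a)\in\mathbb{K}$, $y\in S$, is the controlled transition law ($p_{xy}(a)\ge 0$, $\sum_y p_{xy}(a)=1$). Policies. $\mathbb{H}_0:=S$ and $\mathbb{H}_t:=\mathbb{K}\times\mathbb{H}_{t-1}$ for $t\ge1$; an element of $\mathbb{H}_t$ is $\mathbf{h}_t=(x_0,a_0,\ldots,x_{t-1},a_{t-1},x_t)$ with $a_i\in A(x_i)$. A policy $\pi=\{\pi_t\}_{t\in\mathbb{N}}$ assigns to each $\mathbf{h}_t\in\mathbb{H}_t$ a probability measure $\pi_t(\cdot|\mathbf{h}_t)$ on $A$ concentrated on $A(x_t)$; $\mathcal{P}$ is the class of all policies. $P_x^\pi$ is the distribution of the state-action process $\{(X_t,A_t)\}_{t\in\mathbb{N}}$ when $X_0=x$, given $X_0,A_0,\ldots,X_t$ the action $A_t$ has law $\pi_t(\cdot|X_0,A_0,\ldots,X_t)$,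 and, regardless of the earlier history, $X_{t+1}=y$ with probability $p_{X_ty}(A_t)$; $E_x^\pi$ is the expectation. $\mathbb{F}:=\prod_{x\in S}A(x)$ is identified with the class of stationary policies ($A_t=f(X_t)$ for all $t$). $\min\emptyset=\infty$. Performance index. For $\lambda>0$, $\pi\in\mathcal{P}$, $x\in S$, $n\ge1$, $$J_n(\lambda,\pi,x):=\frac1\lambda\log E_x^\pi\Big[\exp\Big\{\lambda\sum_{t=0}^{n-1}C(X_t,A_t)\Big\}\Big],\quad J(\lambda,\pi,x):=\limsup_{n\to\infty}\frac1nJ_n(\lambda,\pi,x),\quad J^*(\lambda,x):=\inf_{\pi\in\mathcal{P}}J(\lambda,\pi,x).$$ The class $\mathcal{G}$ (depending on $\lambda$). $\mathcal{G}$ consists of all functions $g:S\to\mathbb{R}$ such that: (i) for each $x\in S$, $g(x)=\min_{a\in A(x)}\max\{g(y)\mid p_{xy}(a)>0\}$; (ii) there exists a function $h:S\to\mathbb{R}$, possibly depending on $g$, such that for every $x\in S$ $$e^{\lambda g(x)+\lambda h(x)}\ge\min_{a\in B_g(x)}\Big[e^{\lambda C(x,a)}\sum_y p_{xy}(a)e^{\lambda h(y)}\Big],$$ where $B_g(x):=\{a\in A(x)\mid g(x)=\max\{g(y)\mid p_{xy}(a)>0\}\}$. *)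

(* Defs.v *)
From HB Require Import structures.
From mathcomp Require Import all_boot all_order all_algebra.
From mathcomp Require Import all_classical all_reals all_analysis.
From mathcomp Require Import ring lra.

Set Implicit Arguments.
Unset Strict Implicit.
Unset Printing Implicit Defensive.

Import Order.TTheory GRing.Theory Num.Theory.

Local Open Scope classical_set_scope.
Local Open Scope ring_scope.

(* Only the values of [cost x a] and [trans x a y] with [a \in adm x] matter. *)
Record mdp (R : realType) (S A : finType) := Mdp {
  state_inhabited : (0 < #|S|)%N;
  adm : S -> {set A};
  adm_neq0 : forall x, adm x != finset.set0;
  cost : S -> A -> R;
  trans : S -> A -> S -> R;
  trans_ge0 : forall x a y, a \in adm x -> 0 <= trans x a y;
  trans_sum1 : forall x a, a \in adm x -> \sum_y trans x a y = 1
}.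

Section Trajectories.
Context {R : realType} {S A : finType} (M : mdp R S A).

Definition KK : Type := {xa : S * A | xa.2 \in adm M xa.1}.

HB.instance Definition _ := Finite.on KK.

Lemma KK_inhabited : inhabited KK.
Proof.
have /card_gt0P[x _] := state_inhabited M.
have /set0Pn[a xa] := adm_neq0 M x.
by constructor; exists (x, a).
Qed.

HB.instance Definition _ := isPointed.Build KK (inhabited_witness KK_inhabited).

Definition cylinders : set (set (nat -> KK)) :=
  [set [set w : nat -> KK | w t = k] | t in [set: nat] & k in [set: KK]].

(* The canonical space of trajectories, with the product sigma-algebra. *)
Definition traj := g_sigma_algebraType cylinders.

Definition X_ (t : nat) (w : traj) : S := (val (w t)).1.
Definition A_ (t : nat) (w : traj) : A := (val (w t)).2.

Definition hist (t : nat) : Type := (t.-tuple KK * S)%type.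

Definition hist_at (t : nat) (w : traj) : hist t :=
  ([tuple w i | i < t], X_ t w).

Record policy := Policy {
  pol :> forall t, hist t -> A -> R;
  pol_ge0 : forall t h a, 0 <= @pol t h a;
  pol_sum1 : forall t h, \sum_a @pol t h a = 1;
  pol_adm : forall t (h : hist t) a, a \notin adm M h.2 -> pol h a = 0
}.

(* X_0 = x, A_t has conditional law pi_t given the history up to X_t, and
   X_{t+1} has conditional law trans X_t A_t given the history up to A_t.
   Conditional laws are multiplied out to avoid dividing by null events; these
   identities determine P, since they give it on the finite cylinders. *)
Definition is_law (pi : policy) (x : S) (P : probability traj R) : Prop :=
  [/\ P [set w | X_ 0 w = x] = 1%E,
      forall t (h : hist t) a,
        P [set w | hist_at t w = h /\ A_ t w = a] =
        ((pi t h a)%:E * P [set w | hist_at t w = h])%E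
    & forall t (h : hist t) a y,
        P [set w | [/\ hist_at t w = h, A_ t w = a & X_ t.+1 w = y]] =
        ((trans M h.2 a y)%:E *
          P [set w | hist_at t w = h /\ A_ t w = a])%E].

End Trajectories.

(* Existence of the law: the cylinders are coded by nested subintervals of
   [0, 1[ whose lengths are the prescribed probabilities, and the law is the
   image of the Lebesgue measure on [0, 1[ under this coding. *)
Section Coding.
Context {R : realType} {E : finType} (e0 : E) (q : nat -> (nat -> E) -> E -> R).
Hypothesis q_ge0 : forall t w e, 0 <= q t w e.
Hypothesis q_sum1 : forall t w, \sum_e q t w e = 1.
Hypothesis q_ext : forall t w w' e,
  (forall i, (i < t)%N -> w i = w' i) -> q t w e = q t w' e.

Definition code_cum t w (e : E) : R :=
  \sum_(e' | (enum_rank e' < enum_rank e)%N) q t w e'.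
Definition code_len t w : R := \prod_(i < t) q i w (w i).
Definition code_left t w : R := \sum_(i < t) code_len i w * code_cum i w (w i).
Definition code_itv t w (u : R) : bool :=
  (code_left t w <= u) && (u < code_left t w + code_len t w).
Definition upd (w : nat -> E) t e : nat -> E :=
  fun i => if i == t then e else w i.

Let agree t (w w' : nat -> E) := forall i, (i < t)%N -> w i = w' i.

Lemma code_len_ge0 t w : 0 <= code_len t w.
Proof. exact: prodr_ge0. Qed.

Lemma code_cum_ge0 t w e : 0 <= code_cum t w e.
Proof. exact: sumr_ge0. Qed.

Lemma code_len_ext t w w' : agree t w w' -> code_len t w = code_len t w'.
Proof.
move=> ww'; apply: eq_bigr => i _; rewrite ww'//.
by apply: q_ext => j ji; apply: ww'; apply: ltn_trans ji _.
Qed.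

Lemma code_left_ext t w w' : agree t w w' -> code_left t w = code_left t w'.
Proof.
move=> ww'; apply: eq_bigr => i _; rewrite ww'//; congr (_ * _).
  by apply: code_len_ext => j ji; apply: ww'; apply: ltn_trans ji _.
apply: eq_bigr => e _.
by apply: q_ext => j ji; apply: ww'; apply: ltn_trans ji _.
Qed.

Lemma code_lenS t w : code_len t.+1 w = code_len t w * q t w (w t).
Proof. by rewrite /code_len big_ord_recr. Qed.

Lemma code_leftS t w :
  code_left t.+1 w = code_left t w + code_len t w * code_cum t w (w t).
Proof. by rewrite /code_left big_ord_recr. Qed.

Lemma upd_agree t w e : agree t w (upd w t e).
Proof. by move=> i it; rewrite /upd ltn_eqF. Qed.

Lemma code_cum_le t w e : code_cum t w e + q t w e <= 1.
Proof.
rewrite -(q_sum1 t w) (bigID (fun e' => enum_rank e' < enum_rank e)%N)/=.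
rewrite lerD2l [leRHS](bigD1 e)/= ?ltnn// lerDl.
exact: sumr_ge0.
Qed.

Lemma code_cum_lt t w e e' : (enum_rank e < enum_rank e')%N ->
  code_cum t w e + q t w e <= code_cum t w e'.
Proof.
move=> ee'; rewrite {2}/code_cum (bigID (fun f => enum_rank f < enum_rank e)%N)/=.
apply: lerD.
  rewrite /code_cum le_eqVlt; apply/orP; left; apply/eqP.
  apply: eq_bigl => f; case: (ltnP (enum_rank f) (enum_rank e)) => h.
    by rewrite (ltn_trans h ee').
  by rewrite andbF.
rewrite (bigD1 e)/= ?ltnn ?ee'// lerDl; exact: sumr_ge0.
Qed.

Lemma code_itvW t w u : code_itv t.+1 w u -> code_itv t w u.
Proof.
rewrite /code_itv code_leftS code_lenS => /andP[lu ur].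
have L0 := code_len_ge0 t w.
have c0 := code_cum_ge0 t w (w t).
have cq := code_cum_le t w (w t).
have h1 : 0 <= code_len t w * code_cum t w (w t) by rewrite mulr_ge0.
have h2 : code_len t w * (code_cum t w (w t) + q t w (w t)) <= code_len t w * 1.
  by rewrite ler_wpM2l.
apply/andP; split; first lra.
by move: h2; rewrite mulrDr; lra.
Qed.

Lemma code_itv_inj t w w' u : code_itv t w u -> code_itv t w' u -> agree t w w'.
Proof.
elim: t w w' => [//|t IH] w w' wu w'u.
have ww' : agree t w w' by apply: IH; exact: code_itvW.
suff wt : w t = w' t.
  by move=> i; rewrite ltnS leq_eqVlt => /orP[/eqP->//|]; exact: ww'.
move: wu w'u; rewrite /code_itv !code_leftS !code_lenS.
rewrite -(code_left_ext ww') -(code_len_ext ww').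
rewrite -(q_ext _ ww').
have -> e : code_cum t w' e = code_cum t w e.
  by apply: eq_bigr => f _; apply/esym/q_ext.
have L0 := code_len_ge0 t w.
move=> /andP[a1 a2] /andP[b1 b2].
apply: enum_rank_inj; apply/val_inj => /=; apply/eqP; rewrite eqn_leq.
apply/andP; split; rewrite leqNgt; apply/negP => /(code_cum_lt t w) h.
  have := ler_wpM2l L0 h; rewrite mulrDr; lra.
have := ler_wpM2l L0 h; rewrite mulrDr; lra.
Qed.

Lemma code_step t w u : code_itv t w u -> exists e, code_itv t.+1 (upd w t e) u.
Proof.
move=> /andP[lu ur].
pose C j : R := \sum_(e | (enum_rank e < j)%N) q t w e.
have exj : exists j, u < code_left t w + code_len t w * C j.
  exists #|E|; rewrite [C _](_ : _ = 1) ?mulr1//.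
  by rewrite -(q_sum1 t w); apply: eq_bigl => e; rewrite ltn_ord.
case: (ex_minnP exj) => -[|j] hj jmin.
  by move: hj; rewrite /C big_pred0// mulr0 addr0; lra.
have jE : (j < #|E|)%N.
  rewrite ltnNge; apply/negP => Ej.
  suff: (j < j)%N by rewrite ltnn.
  apply: jmin; rewrite (_ : C j = C j.+1)//; apply: eq_bigl => e.
  by rewrite ltnS (leq_trans (ltn_ord _) Ej) (leq_trans (ltnW (ltn_ord _)) Ej).
pose e := enum_val (Ordinal jE).
have re : enum_rank e = j :> nat by rewrite /e enum_valK.
exists e; rewrite /code_itv code_leftS code_lenS.
rewrite -(code_left_ext (@upd_agree t w e)) -(code_len_ext (@upd_agree t w e)).
rewrite -(q_ext _ (@upd_agree t w e)).
have -> : upd w t e t = e by rewrite /upd eqxx.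
have -> : code_cum t (upd w t e) e = C j.
  rewrite /code_cum re; apply: eq_bigr => f _.
  by apply/esym/q_ext/upd_agree.
have CS : C j.+1 = C j + q t w e.
  rewrite /C (bigD1 e)/= ?re// addrC; congr (_ + _).
  apply: eq_bigl => f; rewrite ltnS leq_eqVlt.
  have -> : (f == e) = (enum_rank f == j :> nat).
    by rewrite -re; apply/eqP/eqP => [->//|/val_inj/enum_rank_inj].
  by case: ltngtP.
rewrite -addrA -mulrDr -CS hj andbT leNgt; apply/negP => /jmin.
by rewrite ltnn.
Qed.

Lemma coding : exists phi : R -> nat -> E, forall t w,
  [set u | (u \in `[0, 1[) /\ agree t (phi u) w] =
  `[code_left t w, code_left t w + code_len t w[%classic.
Proof.
have /choice[phi phiP] : forall u : R, exists v : nat -> E,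
    u \in `[0, 1[ -> forall t, code_itv t v u.
  move=> u; have [u01|] := boolP (u \in `[0, 1[); last by exists (fun=> e0).
  pose nxt t w := if pselect (exists e, code_itv t.+1 (upd w t e) u) is left ex
    then projT1 (cid ex) else e0.
  pose W := fix W t := if t is s.+1 then upd (W s) s (nxt s (W s))
    else fun=> e0.
  have WI t : code_itv t (W t) u.
    elim: t => [|t IH].
      rewrite /code_itv /code_left /code_len !big_ord0 add0r.
      by move: u01; rewrite in_itv.
    rewrite /= /nxt; case: pselect => [ex|/(_ (code_step IH))//].
    by case: cid.
  exists (fun t => W t.+1 t) => _ t.
  have WE : agree t (W t) (fun t => W t.+1 t).
    elim: t => [//|t IH] i; rewrite ltnS leq_eqVlt => /orP[/eqP->//|it].
    by rewrite -(IH _ it) /= /upd ltn_eqF.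
  by rewrite /code_itv -(code_left_ext WE) -(code_len_ext WE); exact: WI.
exists phi => t w; apply/seteqP; split => u /=.
  move=> [u01 uw]; rewrite in_itv/= -(code_left_ext uw) -(code_len_ext uw).
  exact: phiP.
rewrite in_itv/= => wu.
have u01 : u \in `[0, 1[.
  have {wu} : code_itv t w u by [].
  elim: t => [|t IH]; last by move/code_itvW.
  by rewrite /code_itv /code_left /code_len !big_ord0 add0r in_itv.
by split=> //; apply: code_itv_inj wu; apply: phiP.
Qed.

End Coding.

Section UnitMeasure.
Context (R : realType).

Definition unit_itv : set (measurableTypeR R) := `[0, 1[%classic.

Lemma unit_itv_measurable : measurable unit_itv.
Proof. exact: measurable_itv. Qed.

Definition unit_measure : set (measurableTypeR R) -> \bar R :=
  mrestr (@lebesgue_measure R) unit_itv_measurable.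

HB.instance Definition _ := Measure.on unit_measure.

Lemma unit_measureT : unit_measure setT = 1%E.
Proof.
rewrite /unit_measure /mrestr setTI /unit_itv lebesgue_measure_itv/= lte01.
by rewrite sube0.
Qed.

HB.instance Definition _ :=
  Measure_isProbability.Build _ _ _ unit_measure unit_measureT.

End UnitMeasure.

Section Law.
Context {R : realType} {S A : finType} (M : mdp R S A).
Context (pi : policy M) (x : S).
Local Notation K := (KK M).
Local Notation traj := (traj M).

Let g t (w : nat -> K) (y : S) : R :=
  if t is s.+1 then trans M (val (w s)).1 (val (w s)).2 y else (y == x)%:R.

Let q t (w : nat -> K) (k : K) : R :=
  g t w (val k).1 * pi t ([tuple w i | i < t], (val k).1) (val k).2.

Let g_ge0 t w y : 0 <= g t w y.
Proof. by case: t => [|t] /=; [exact: ler0n|apply: trans_ge0; exact: (valP (w t))]. Qed.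

Let g_sum1 t w : \sum_y g t w y = 1.
Proof.
case: t => [|t] /=; last by apply: trans_sum1; exact: (valP (w t)).
by rewrite (bigD1 x)//= eqxx big1 ?addr0// => y /negPf ->.
Qed.

Let q_ge0 t w k : 0 <= q t w k.
Proof. by rewrite mulr_ge0 ?g_ge0 ?pol_ge0. Qed.

Let sumKK (F : S -> A -> R) : (forall y a, a \notin adm M y -> F y a = 0) ->
  \sum_(k : K) F (val k).1 (val k).2 = \sum_y \sum_a F y a.
Proof.
move=> F0; rewrite pair_big/=.
rewrite (bigID (fun p : S * A => p.2 \in adm M p.1))/= [X in _ + X]big1 ?addr0.
  by rewrite (big_sub [pred p : S * A | p.2 \in adm M p.1]
    (fun p => F p.1 p.2)).
by move=> p /F0.
Qed.

Let q_sum1 t w : \sum_k q t w k = 1.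
Proof.
rewrite (sumKK (F := fun y a => g t w y * pi t ([tuple w i | i < t], y) a)).
  rewrite -(g_sum1 t w); apply: eq_bigr => y _.
  by rewrite -mulr_sumr pol_sum1 mulr1.
by move=> y a ya; rewrite pol_adm ?mulr0.
Qed.

Let q_ext t w w' k :
  (forall i, (i < t)%N -> w i = w' i) -> q t w k = q t w' k.
Proof.
move=> ww'; rewrite /q; congr (_ * pi t (_, _) _).
  by case: t ww' => [//|t] ww' /=; rewrite ww'.
by apply: eq_from_tnth => i; rewrite !tnth_mktuple ww'.
Qed.

Local Notation D := (@unit_itv R).
Let mD : measurable D := @unit_itv_measurable R.
Let k0 : K := point.
Let len := code_len q.
Let pre t (w : nat -> K) : set traj :=
  [set v | forall i, (i < t)%N -> v i = w i].

Let m_coord t k : measurable [set v : traj | v t = k].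
Proof. by apply: sub_sigma_algebra; exists t => //; exists k. Qed.

Lemma prefix_law : exists P : probability traj R,
  forall t w, P (pre t w) = (len t w)%:E.
Proof.
have [phi phiP] := coding (point : K) q_ge0 q_sum1 q_ext.
pose phi' : R -> nat -> K := fun u => if u \in `[0, 1[ then phi u else (fun=> k0).
have phi'P t w : (phi' : R -> traj) @^-1` (pre t w) `&` D =
    `[code_left q t w, code_left q t w + len t w[%classic.
  rewrite -phiP; apply/seteqP; split=> u /=.
    by rewrite /phi' => -[+ uD]; rewrite ifT.
  by rewrite /phi' => -[uD uw]; rewrite ifT.
have mpre t w : measurable ((phi' : R -> traj) @^-1` (pre t w) `&` D).
  by rewrite phi'P; exact: measurable_itv.
have mphi : measurable_fun [set: measurableTypeR R] (phi' : _ -> traj).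
  apply: (@measurability _ _ (measurableTypeR R) traj setT phi' (@cylinders _ _ _ M)) => //.
  move=> _ [_ [t _] [k _ <-] <-]; rewrite setTI.
  rewrite -[X in measurable X](setUIDK _ D); apply: measurableU.
    rewrite (_ : _ `&` _ = \bigcup_(u in [set: t.-tuple K])
        ((phi' : R -> traj) @^-1` (pre t.+1 (nth k (rcons u k))) `&` D)).
      by apply: fin_bigcup_measurable => // u _; exact: mpre.
    apply/seteqP; split=> [r /= [rk rD]|r [u _ /= [ru rD]]].
      exists [tuple phi' r i | i < t] => //=; split=> // i.
      rewrite ltnS nth_rcons size_map size_enum_ord leq_eqVlt.
      case/orP => [/eqP->|it]; first by rewrite ltnn eqxx.
      rewrite it -[RHS](_ : tnth [tuple phi' r i | i < t] (Ordinal it) = _).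
        by rewrite tnth_mktuple.
      by rewrite (tnth_nth k).
    split=> //; rewrite (ru t)//.
    by rewrite nth_rcons size_tuple ltnn eqxx.
  have [kp|kp] := pselect (k0 = k).
    rewrite (_ : _ `\` _ = ~` D); first exact: measurableC.
    apply/seteqP; split=> [r [] //|r rD]; split=> //=.
    by rewrite /phi' ifF//; apply/negP.
  rewrite (_ : _ `\` _ = set0)//.
  apply/seteqP; split=> // r [/= + rD].
  by rewrite /phi' ifF//; apply/negP.
pose phi_ : {mfun measurableTypeR R >-> traj} := mfun_Sub (mem_set mphi).
exists (distribution (@unit_measure R) phi_) => t w.
rewrite -[LHS]/(@lebesgue_measure R ((phi' : R -> traj) @^-1` (pre t w) `&` D)).
rewrite phi'P.
rewrite lebesgue_measure_itv/= lte_fin.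
have := code_len_ge0 q_ge0 t w; rewrite -/(len t w) le_eqVlt => /orP[/eqP<-|l0].
  by rewrite addr0 ltxx.
by rewrite ltrDl l0 -EFinB addrAC subrr add0r.
Qed.

Lemma law_exists : exists P, is_law pi x P.
Proof.
have [P PE] := prefix_law; exists P.
have lenS t w : len t.+1 w = len t w * q t w (w t) by exact: code_lenS.
have mpre t w : measurable (pre t w).
  rewrite (_ : pre t w = \bigcap_(i in `I_t) [set v : traj | v i = w i])//.
  by apply: bigcap_measurableType => i _; exact: m_coord.
have preS t w k : pre t.+1 (upd w t k) = pre t w `&` [set v | v t = k].
  apply/seteqP; split=> v /=.
    move=> h; split=> [i it|]; last by rewrite h// /upd eqxx.
    by rewrite (h i (ltnW it)) /upd ltn_eqF.
  move=> [h vt] i; rewrite ltnS leq_eqVlt /upd => /orP[/eqP->|it].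
    by rewrite eqxx.
  by rewrite ltn_eqF// h.
have PS t w k : P (pre t w `&` [set v | v t = k]) = (len t w * q t w k)%:E.
  rewrite -preS PE lenS /upd eqxx.
  have a : forall i, (i < t)%N -> upd w t k i = w i.
    by move=> i it; rewrite /upd ltn_eqF.
  by rewrite (q_ext k a) /len (code_len_ext q_ext a).
have PX t w y : P (pre t w `&` [set v | X_ t v = y]) = (len t w * g t w y)%:E.
  pose F (k : K) : set traj :=
    if (val k).1 == y then pre t w `&` [set v | v t = k] else set0.
  have -> : pre t w `&` [set v | X_ t v = y] = \bigcup_(k in setT) F k.
    apply/seteqP; split=> [v [vw vy]|v [k _]]; rewrite /F/=.
      by exists (v t) => //; rewrite -vy eqxx.
    case: eqP => [ky [vw vk]|_ []]; split=> //=.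
    by rewrite /X_ vk.
  rewrite measure_fin_bigcup; last first.
  - move=> k _; rewrite /F; case: ifP => // _.
    exact: (measurableI _ _ (mpre t w) (m_coord t k)).
  - move=> k k' _ _ [v []]; rewrite /F; case: ifP => // _ [_ vk].
    by case: ifP => // _ [_ vk']; rewrite -vk -vk'.
  - exact: finite_finset.
  rewrite (_ : [set: K] = [set` enum {: K}]); last first.
    by apply/seteqP; split=> // k _ /=; rewrite mem_enum.
  rewrite -fsbig_seq ?enum_uniq// big_enum/=.
  under eq_bigr => k _.
    rewrite (_ : _ (F k) = (((val k).1 == y)%:R * (len t w * q t w k))%:E); last first.
      by rewrite /F; case: ifP => _; rewrite ?mul1r ?mul0r ?PS ?measure0.
    over.
  rewrite sumEFin; congr (_%:E).
  rewrite (sumKK (F := fun y' a => (y' == y)%:R *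
    (len t w * (g t w y' * pi t ([tuple w i | i < t], y') a)))); last first.
    by move=> y' a ya; rewrite pol_adm// !mulr0.
  rewrite (bigD1 y)//= [X in _ + X]big1 ?addr0; last first.
    by move=> y' /negPf ->; apply: big1 => a _; rewrite mul0r.
  under eq_bigr do rewrite eqxx mul1r mulrA.
  by rewrite -mulr_sumr pol_sum1 mulr1.
pose wh t (h : hist M t) : nat -> K := nth k0 h.1.
have histE t (h : hist M t) : [set v : traj | hist_at t v = h] =
    pre t (wh t h) `&` [set v | X_ t v = h.2].
  apply/seteqP; split=> v.
    move=> /= <-; split=> // i it.
    rewrite /wh /= -[RHS](_ : tnth [tuple v i | i < t] (Ordinal it) = _).
      by rewrite tnth_mktuple.
    by rewrite (tnth_nth k0).
  case: h => u y [/= vw <-]; congr (_, _); apply: eq_from_tnth => i.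
  by rewrite tnth_mktuple vw// (tnth_nth k0).
have whE t (h : hist M t) : [tuple wh t h i | i < t] = h.1.
  by apply: eq_from_tnth => i; rewrite tnth_mktuple (tnth_nth k0).
have PA t (h : hist M t) k : (val k).1 = h.2 ->
    [set v : traj | hist_at t v = h /\ A_ t v = (val k).2] =
    pre t (wh t h) `&` [set v | v t = k].
  move=> kh; rewrite -[LHS]/([set v : traj | hist_at t v = h] `&`
    [set v | A_ t v = (val k).2]) histE.
  apply/seteqP; split=> [v [[vw vx] va]|v [vw /= vk]]; split=> //=.
  - apply: val_inj; rewrite [LHS]surjective_pairing [RHS]surjective_pairing.
    by rewrite kh -va; congr (_, _); exact: vx.
  - by split=> //=; rewrite /X_ vk.
  - by rewrite /A_ vk.
have noA t (h : hist M t) a : a \notin adm M h.2 ->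
    [set v : traj | hist_at t v = h /\ A_ t v = a] = set0.
  move=> ah; apply/seteqP; split=> // v [vh va]; move: ah.
  by rewrite -vh -va /= (valP (v t)).
split.
- rewrite (_ : mkset _ = pre 0 (fun=> k0) `&` [set v | X_ 0 v = x]).
    by rewrite PX /= eqxx mulr1 /len /code_len big_ord0.
  by apply/seteqP; split=> v //= [].
- move=> t h a; have [ah|ah] := boolP (a \in adm M h.2); last first.
    by rewrite noA// measure0 pol_adm// mul0e.
  pose k : K := exist _ (h.2, a) ah.
  rewrite (PA t h k erefl) PS histE PX -EFinM /q /= whE -surjective_pairing.
  by congr (_%:E); ring.
- move=> t h a y; have [ah|ah] := boolP (a \in adm M h.2); last first.
    rewrite noA// measure0 mule0 (_ : mkset _ = set0) ?measure0//.
    by apply/seteqP; split=> // v [vh va _]; rewrite -(noA t h a ah).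
  pose k : K := exist _ (h.2, a) ah.
  have -> : [set v : traj | [/\ hist_at t v = h, A_ t v = a & X_ t.+1 v = y]] =
      pre t.+1 (upd (wh t h) t k) `&` [set v | X_ t.+1 v = y].
    rewrite preS -(PA t h k erefl).
    by apply/seteqP; split=> v /= [] => [? ? ?|[]].
  rewrite PX (PA t h k erefl) -preS PE -EFinM /= /upd eqxx /=.
  by rewrite mulrC.
Qed.

End Law.

Section RiskSensitiveCost.
Context {R : realType} {S A : finType} (M : mdp R S A).
Local Open Scope ereal_scope.

(* P_x^pi *)
Definition process_law (pi : policy M) (x : S) : probability (traj M) R :=
  projT1 (cid (law_exists pi x)).

Lemma process_lawP (pi : policy M) (x : S) : is_law pi x (process_law pi x).
Proof. by rewrite /process_law; case: cid. Qed.

Definition selector := {f : S -> A | forall x, f x \in adm M x}.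

Lemma stationary_ge0 (f : selector) t (h : hist M t) a :
  (0 <= (a == sval f h.2)%:R :> R)%R.
Proof. exact: ler0n. Qed.

Lemma stationary_sum1 (f : selector) t (h : hist M t) :
  (\sum_a (a == sval f h.2)%:R = 1 :> R)%R.
Proof.
by rewrite (bigD1 (sval f h.2))//= eqxx big1 ?addr0// => a /negPf ->.
Qed.

Lemma stationary_adm (f : selector) t (h : hist M t) a :
  a \notin adm M h.2 -> ((a == sval f h.2)%:R = 0 :> R)%R.
Proof. by case: eqP => // ->; rewrite (svalP f). Qed.

Definition stationary (f : selector) : policy M :=
  Policy (stationary_ge0 f) (stationary_sum1 f) (@stationary_adm f).

Definition J_ (lam : R) (pi : policy M) (x : S) (n : nat) : R :=
  (lam^-1 * ln (fine 'E_(process_law pi x)[fun w =>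
    expR (lam * \sum_(t < n) cost M (X_ t w) (A_ t w))]))%R.

(* The limsup is over n >= 1; the term n = 0 does not affect it. *)
Definition J (lam : R) (pi : policy M) (x : S) : \bar R :=
  limn_esup (fun n => (n%:R^-1 * J_ lam pi x n)%:E).

Definition Jopt (lam : R) (x : S) : \bar R :=
  ereal_inf [set J lam pi x | pi in [set: policy M]].

(* T = min {n > 0 | X_n = z}; as ereal_inf set0 = +oo, this is the minimum, with
   min set0 = +oo. *)
Definition return_time (z : S) (w : traj M) : \bar R :=
  ereal_inf [set n%:R%:E | n in [set n : nat | (0 < n)%N /\ X_ n w = z]].

Definition doeblin : Prop :=
  exists (z : S) (B : R), (0 < B)%R /\
    forall (x : S) (f : selector),
      \int[process_law (stationary f) x]_w return_time z w <= B%:E.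

(* The ranges of the minima and maxima below are finite, and +oo, resp. -oo, is
   only the value over an empty range, so computing them in \bar R is harmless. *)
Definition succ_max (g : S -> R) (x : S) (a : A) : \bar R :=
  \big[maxe/-oo]_(y | (0 < trans M x a y)%R) (g y)%:E.

Definition B_ (g : S -> R) (x : S) : {set A} :=
  [set a in adm M x | (g x)%:E == succ_max g x a]%SET.

Definition GG (lam : R) : set (S -> R) :=
  [set g | (forall x, (g x)%:E = \big[mine/+oo]_(a in adm M x) succ_max g x a)
    /\ exists h : S -> R, forall x,
         (expR (lam * g x + lam * h x))%:E >=
         \big[mine/+oo]_(a in B_ g x)
           (expR (lam * cost M x a) *
             \sum_y trans M x a y * expR (lam * h y))%:E].

End RiskSensitiveCost.

(* Main.v *)
(* With c = lam * cost, let Psi v x be the minimum over a of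
   c x a + ln (\sum_y p_xy(a) exp (v y)).  For a discount b in (0, 1], take V with
   V = Psi ((1 - b) V) up to an error b; then b V stays bounded, and a cluster
   point g as b -> 0 satisfies g x = min_a max {g y | p_xy(a) > 0}.  Since
   (1 - b) V = V - b V with b V close to g, the same V shows, for b small, both
   that (g + e) / lam lies in GG and that h := V satisfies
   Psi (h + t g) >= h + (t + 1) g - e for every t >= 0: the successors y with
   g y < g x are negligible there because V x - V y is of order (g x - g y) / b.
   The second inequality iterates to J(pi, x) >= g x / lam for every policy pi,
   while any element of GG bounds the cost of the stationary policy that selects
   the minimizing actions. *)
Require Import Defs.
From mathcomp Require Import all_boot all_order all_algebra.
From mathcomp Require Import all_classical all_reals all_analysis.
From mathcomp Require Import measurable_realfun ring lra.
Set Implicit Arguments.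
Unset Strict Implicit.
Import Order.TTheory GRing.Theory Num.Theory.
Import numFieldNormedType.Exports.
Local Open Scope classical_set_scope.
Local Open Scope ring_scope.

(** * Bounds, gaps and cluster points for functions on a finite set *)

Section FiniteFamilies.
Context {R : realType}.

Lemma finite_bound (I : finType) (f : I -> R) :
  exists2 K : R, 0 <= K & forall i, `|f i| <= K.
Proof.
exists (\sum_i `|f i|); first exact: sumr_ge0.
by move=> i; rewrite (bigD1 i)//= lerDl sumr_ge0.
Qed.

(** Makes approximate inequalities between the values of [f] exact: an error below [d] cannot hide a
    strict inequality. The default 1 of the minimum covers a constant [f]. *)
Lemma finite_gap (I : finType) (f : I -> R) :
  exists2 d : R, 0 < d & forall i j, f i < f j -> f i + d <= f j.
Proof.
exists (\big[Order.min/1]_(p : I * I | f p.1 < f p.2) (f p.2 - f p.1)).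
  by apply/bigmin_gtP; split=> // p; rewrite subr_gt0.
move=> i j fij; rewrite addrC -lerBrDr.
exact: (@bigmin_le_cond _ _ _ _ (i, j)).
Qed.

(** Functions on [S] are coded as row vectors, which here stay in the compact box of side
    [[- K, K]]. *)
Lemma bounded_seq_cluster (S : finType) (u : nat -> S -> R) (K : R) :
  (forall n x, `|u n x| <= K) ->
  exists g : S -> R, forall (e : R) (N : nat), 0 < e ->
    exists2 n, (N <= n)%N & forall x, `|u n x - g x| < e.
Proof.
move=> uK.
pose r n : 'rV[R]_#|S| := \row_i u n (enum_val i).
have rK : (r @ \oo) [set v : 'rV[R]_#|S| | forall i, `[- K, K]%classic (v ord0 i)].
  by exists 0%N => // n _ i; rewrite /= mxE in_itv/= -ler_norml.
have [g [_ gr]] := @rV_compact R #|S| (fun=> `[- K, K]%classic)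
  (fun=> @segment_compact R _ _) (r @ \oo) _ rK.
exists (fun x => g ord0 (enum_rank x)) => e N e0.
have [_ [/= [n Nn <-] gn]] := gr (r @` [set n | (N <= n)%N]) (ball g e)
  ltac:(by exists N => // n Nn; exists n) (nbhsx_ballx g e e0).
exists n => // x; move: gn => [_ /(_ ord0 (enum_rank x))].
by rewrite /r mxE enum_rankK -ball_normE/= distrC.
Qed.

End FiniteFamilies.

(** * The one-step operator, its discounted equation and the vanishing-discount limit *)

Section Operator.
Context {R : realType} {S A : finType} (M : mdp R S A) (c : S -> A -> R).
Implicit Types (v : S -> R) (x y : S) (a : A).

(** Kept in exponential form: the logarithm of its minimum over the admissible [a] is [Psi v x]. *)
Definition step v x a : R := expR (c x a) * \sum_y trans M x a y * expR (v y).

Lemma trans_gt0_ex x a : a \in adm M x -> exists y, 0 < trans M x a y.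
Proof.
move=> xa; apply: contrapT => np.
have := trans_sum1 xa; rewrite big1 => [/esym/eqP|y _]; first by rewrite oner_eq0.
apply/le_anti; rewrite trans_ge0// andbT leNgt.
by apply/negP => p0; apply: np; exists y.
Qed.

(** Terms of zero probability vanish, so only possible successors need comparing; a shift by [d]
    becomes the factor [expR d]. *)
Lemma step_le v v' d x a : a \in adm M x ->
  (forall y, 0 < trans M x a y -> v y <= v' y + d) ->
  step v x a <= expR d * step v' x a.
Proof.
move=> xa vv'; rewrite /step mulrCA ler_wpM2l ?expR_ge0// mulr_sumr.
apply: ler_sum => y _; rewrite mulrCA -expRD.
have := trans_ge0 y xa; rewrite le_eqVlt => /orP[/eqP<-|p0]; first by rewrite !mul0r.
by rewrite ler_pM2l// ler_expR addrC vv'.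
Qed.

Lemma step_ge_term v x a y : a \in adm M x ->
  trans M x a y * expR (c x a + v y) <= step v x a.
Proof.
move=> xa; rewrite /step expRD mulrCA ler_wpM2l ?expR_ge0// (bigD1 y)//= lerDl.
by apply: sumr_ge0 => z _; rewrite mulr_ge0 ?trans_ge0// expR_ge0.
Qed.

Lemma step_gt0 v x a : a \in adm M x -> 0 < step v x a.
Proof.
move=> xa; have [y p0] := trans_gt0_ex xa.
by apply: lt_le_trans (step_ge_term v y xa); rewrite mulr_gt0 ?expR_gt0.
Qed.

(** An average of [expR (v y)] is at most its value at a successor that maximizes [v]. *)
Lemma step_le_term v x a : a \in adm M x ->
  exists2 y, 0 < trans M x a y & step v x a <= expR (c x a + v y).
Proof.
move=> xa; have [y0 p0] := trans_gt0_ex xa.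
pose y := [arg max_(y > y0 | 0 < trans M x a y) v y]%O.
have [yp ymax] : 0 < trans M x a y /\ forall z, 0 < trans M x a z -> v z <= v y.
  by rewrite /y; case: arg_maxP => // z zp zm; split.
exists y => //.
have /(step_le (v' := fun=> 0) (d := v y) xa)/le_trans : forall z,
    0 < trans M x a z -> v z <= 0 + v y by move=> z /ymax; rewrite add0r.
apply; rewrite /step -mulr_suml trans_sum1// expR0 !mulr1 -expRD.
by rewrite addrC.
Qed.

Lemma bellman : exists T : (S -> R) -> S -> R, forall v x,
  (forall a, a \in adm M x -> expR (T v x) <= step v x a) /\
  exists2 a, a \in adm M x & step v x a = expR (T v x).
Proof.
have /choice[T TP] : forall vx : (S -> R) * S, exists t : R,
    (forall a, a \in adm M vx.2 -> expR t <= step vx.1 vx.2 a) /\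
    exists2 a, a \in adm M vx.2 & step vx.1 vx.2 a = expR t.
  move=> [v x] /=; have /set0Pn[a0 xa0] := adm_neq0 M x.
  case: (arg_minP (step v x) xa0) => a xa amin.
  have E : expR (ln (step v x a)) = step v x a by rewrite lnK// posrE step_gt0.
  exists (ln (step v x a)); rewrite E; split; first exact: amin.
  by exists a.
by exists (fun v x => T (v, x)) => v x; exact: (TP (v, x)).
Qed.

(** Value iteration from 0: the discounted operator contracts the sup norm by [1 - b], so a late
    iterate solves the equation up to [e]. *)
Lemma discounted_approx (K b e : R) :
  (forall x a, `|c x a| <= K) -> 0 < b <= 1 -> 0 < e ->
  exists V : S -> R, [/\ forall x, `|b * V x| <= K,
    forall x a, a \in adm M x -> expR (V x - e) <= step (fun y => (1 - b) * V y) x a &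
    forall x, exists2 a, a \in adm M x &
      step (fun y => (1 - b) * V y) x a <= expR (V x + e)].
Proof.
move=> cK /andP[b0 b1] e0; have [T TP] := bellman.
have Tle v v' d : (forall y, v y <= v' y + d) -> forall x, T v x <= T v' x + d.
  move=> vv' x; have [+ _] := TP v x; have [_ [a xa aE] /(_ a xa) h] := TP v' x.
  rewrite -ler_expR expRD mulrC -aE; apply: le_trans h _.
  by apply: step_le => // y _.
pose W n := iter n (fun v => T (fun y => (1 - b) * v y)) (fun=> 0).
have b1' : 0 <= 1 - b by rewrite subr_ge0.
have T0 x : `|T (fun=> 0) x| <= K.
  have [h [a xa aE]] := TP (fun=> 0) x.
  have E a' : a' \in adm M x -> step (fun=> 0) x a' = expR (c x a').
    by move=> xa'; rewrite /step -mulr_suml trans_sum1// expR0 !mulr1.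
  have := cK x a; rewrite !ler_norml.
  by move: aE; rewrite E// => /expR_inj ->.
have WS n x : W n.+1 x = T (fun y => (1 - b) * W n y) x by [].
have W1 n x : `|W n.+1 x - W n x| <= (1 - b) ^+ n * K.
  elim: n x => [|n IH] x.
    rewrite WS (_ : (fun y => _) = fun=> 0); last by apply/funext => y; rewrite mulr0.
    by rewrite /= subr0 expr0 mul1r.
  have B y : `|(1 - b) * W n.+1 y - (1 - b) * W n y| <= (1 - b) ^+ n.+1 * K.
    by rewrite -mulrBr normrM ger0_norm// exprS -mulrA ler_wpM2l.
  rewrite (WS n.+1 x) [W n.+1 x]WS ler_norml; apply/andP; split.
    rewrite lerBrDr addrC lerBlDr; apply: Tle => y; cbv beta.
    by have := B y; rewrite ler_norml => /andP[? ?]; lra.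
  rewrite lerBlDr [leRHS]addrC; apply: Tle => y; cbv beta.
  by have := B y; rewrite ler_norml => /andP[? ?]; lra.
(* The bound [K / b] on the iterates reproduces itself, since [K + (1 - b) * (K / b) = K / b]. *)
have Wb n x : `|b * W n x| <= K.
  elim: n x => [|n IH] x; first by rewrite mulr0 normr0 (le_trans _ (T0 x)).
  have h y : `|(1 - b) * W n y| <= (1 - b) * (K / b).
    rewrite normrM ger0_norm// ler_wpM2l// ler_pdivlMr// -[X in _ * X]gtr0_norm//.
    by rewrite -normrM mulrC.
  have u : W n.+1 x <= T (fun=> 0) x + (1 - b) * (K / b).
    rewrite WS; apply: Tle => y; rewrite add0r.
    by have := h y; rewrite ler_norml => /andP[].
  have l : T (fun=> 0) x <= W n.+1 x + (1 - b) * (K / b).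
    rewrite WS; apply: Tle => y; cbv beta.
    by have := h y; rewrite ler_norml => /andP[? ?]; lra.
  have Kb : (1 - b) * (K / b) = K / b - K by field; rewrite gt_eqF.
  rewrite normrM gtr0_norm// mulrC -ler_pdivlMr//.
  by have := T0 x; rewrite !ler_norml => /andP[? ?]; apply/andP; split; lra.
have [n nP] : exists n, (1 - b) ^+ n * K <= e.
  have : (fun n => (1 - b) ^+ n * K) @ \oo --> 0 * K.
    apply: cvgM; last exact: cvg_cst.
    by apply: cvg_expr; rewrite ger0_norm//; lra.
  rewrite mul0r => /cvgr0_norm_lt/(_ _ e0)[n _ /(_ n (leqnn n)) h].
  by exists n; rewrite (le_trans (ler_norm _))// ltW.
exists (W n); split=> // x.
- move=> a xa; have [+ _] := TP (fun y => (1 - b) * W n y) x => /(_ a xa).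
  apply: le_trans; rewrite ler_expR -WS.
  by have := le_trans (W1 n x) nP; rewrite ler_norml => /andP[? ?]; lra.
- have [_ [a xa aE]] := TP (fun y => (1 - b) * W n y) x.
  exists a => //; rewrite aE ler_expR -WS.
  by have := le_trans (W1 n x) nP; rewrite ler_norml => /andP[? ?]; lra.
Qed.

(** The equation is solved with an error equal to the discount itself, so that [d] alone controls
    the discount, the error and the distance to the cluster point [g]. *)
Lemma vanishing_discount (K : R) : (forall x a, `|c x a| <= K) ->
  exists g : S -> R, forall d : R, 0 < d -> exists (b : R) (V : S -> R),
    [/\ 0 < b <= 1, b <= d, forall x, `|b * V x| <= K,
      forall x, `|b * V x - g x| <= d &
      forall x,
        (forall a, a \in adm M x ->
          expR (V x - b) <= step (fun y => (1 - b) * V y) x a) /\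
        exists2 a, a \in adm M x &
          step (fun y => (1 - b) * V y) x a <= expR (V x + b)].
Proof.
move=> cK; pose b n : R := n.+1%:R^-1.
have b01 n : 0 < b n <= 1 by rewrite invr_gt0 ltr0n/= invf_le1 ?ltr0n// ler1n.
have b0 n : 0 < b n by have /andP[] := b01 n.
have /choice[V VP] := fun n => discounted_approx cK (b01 n) (b0 n).
have [g gP] := bounded_seq_cluster (u := fun n x => b n * V n x)
  (fun n => let: And3 h _ _ := VP n in h).
exists g => d d0.
have [N _ Nd] : \forall n \near \oo, b n < d := near_infty_natSinv_lt (PosNum d0).
have [n Nn ng] := gP d N d0; exists (b n), (V n).
have [V1 V2 V3] := VP n; split=> //; first exact: (ltW (Nd n Nn)).
  by move=> x; rewrite ltW// ng.
by move=> x; split; [exact: V2|exact: V3].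
Qed.

(** The first two conclusions put a small upward shift of [g], rescaled by [lam], into [GG]; the
    third bounds the cost of every policy from below. *)
Lemma growth_rate : exists g : S -> R,
  [/\ forall x a, a \in adm M x -> exists2 y, 0 < trans M x a y & g x <= g y,
    forall e : R, 0 < e -> exists h : S -> R, forall x, exists a,
      [/\ a \in adm M x, forall y, 0 < trans M x a y -> g y <= g x &
        step h x a <= expR (g x + e + h x)] &
    forall e : R, 0 < e -> exists h : S -> R, forall (t : nat) x a, a \in adm M x ->
      expR (h x + t.+1%:R * g x - e) <= step (fun y => h y + t%:R * g y) x a].
Proof.
have [K1 K10 K1P] := finite_bound (fun xa : S * A => c xa.1 xa.2).
(* Bounding the logarithms gives a common positive lower bound on the positive transition
   probabilities; the default value of [ln] at the other triples can only enlarge [K2]. *)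
have [K2 K20 K2P] := finite_bound (fun q : S * A * S => ln (trans M q.1.1 q.1.2 q.2)).
have [K [K0 cK pK]] : exists K : R, [/\ 0 <= K, forall x a, `|c x a| <= K &
    forall x a y, 0 < trans M x a y -> expR (- K) <= trans M x a y].
  exists (K1 + K2); split; first exact: addr_ge0.
    by move=> x a; apply: le_trans (K1P (x, a)) _; rewrite lerDl.
  move=> x a y p0; rewrite -[leRHS]lnK ?posrE// ler_expR.
  by have := K2P (x, a, y); rewrite ler_norml => /andP[/= ? _]; lra.
have [g gP] := vanishing_discount cK.
have [gap gap0 gapP] := finite_gap g.
have C0 : 0 < 8 + 8 * K by lra.
(* For [d <= d0] the error [(4 + 4 * K) * d] is at most half the gap between distinct values of [g],
   which yields [gle]. *)
pose d0 := Order.min 1 (gap / (8 + 8 * K)).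
have d00 : 0 < d0 by rewrite lt_min ltr01 divr_gt0.
have gle x y d : d <= d0 -> g x <= g y + (4 + 4 * K) * d -> g x <= g y.
  rewrite le_min => /andP[_]; rewrite ler_pdivlMr// => dd h.
  by rewrite leNgt; apply/negP => /gapP; lra.
have gW b V d x : 0 < b <= 1 -> b <= d -> `|b * V x| <= K ->
    `|b * V x - g x| <= d -> `|b * ((1 - b) * V x) - g x| <= (1 + K) * d.
  move=> /andP[b0 b1] bd bV Vg.
  have -> : b * ((1 - b) * V x) - g x = (b * V x - g x) - b * (b * V x) by ring.
  rewrite (le_trans (ler_normB _ _))// mulrDl mul1r lerD// normrM gtr0_norm//.
  by rewrite mulrC ler_pM// ltW.
exists g; split.
- move=> x a xa; have [b [V [b01 bd VK Vg VP]]] := gP _ d00.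
  (* The exponents of the discounted inequality are compared at the maximizing successor [y] and
     multiplied by [b], which makes the cost term of order [d]. *)
  have [VP1 _] := VP x; have [y p0 ly] := step_le_term (fun y => (1 - b) * V y) xa.
  exists y => //; apply: (gle _ _ _ (lexx d0)).
  have := le_trans (VP1 a xa) ly; rewrite ler_expR => h.
  have /andP[b0 b1] := b01.
  have := ler_wpM2l (ltW b0) h; rewrite mulrBr mulrDr.
  have := gW _ _ _ y b01 bd (VK y) (Vg y); have := Vg x.
  have := cK x a; rewrite !ler_norml => /andP[_ k] /andP[k1 _] /andP[_ k2] k3.
  have : b * c x a <= d0 * K.
    by rewrite (le_trans (ler_wpM2l (ltW b0) k))// ler_wpM2r.
  have : b * b <= d0 * 1 by rewrite ler_pM// ltW.
  have := mulr_ge0 K0 (ltW d00).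
  lra.
- move=> e e0; pose d := Order.min d0 (e / 2).
  have dd0 : d <= d0 by rewrite ge_min lexx.
  have de : d <= e / 2 by rewrite ge_min lexx orbT.
  have d_gt0 : 0 < d by rewrite lt_min d00 divr_gt0.
  have [b [V [b01 bd VK Vg VP]]] := gP _ d_gt0; exists V => x.
  have /andP[b0 b1] := b01.
  have [_ [a xa aV]] := VP x.
  (* A single term of the sum is already bounded by [expR (V x + b)]; multiplied by [b], the cost
     and the log-probability leave only an error of order [d]. *)
  have yx y : 0 < trans M x a y -> g y <= g x.
    move=> p0; apply: (gle _ _ _ dd0).
    have : expR (- K) * expR (c x a + (1 - b) * V y) <= expR (V x + b).
      apply: le_trans aV; apply: le_trans (step_ge_term _ y xa).
      by rewrite ler_wpM2r ?expR_ge0// pK.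
    rewrite -expRD ler_expR => h.
    have := ler_wpM2l (ltW b0) h; rewrite !mulrDr mulrN.
    have := gW _ _ _ y b01 bd (VK y) (Vg y); have := Vg x.
    have := cK x a; rewrite !ler_norml => /andP[k _] /andP[_ k1] /andP[k2 _] k3.
    have : b * (- c x a) <= d * K.
      by rewrite (le_trans (ler_wpM2l (ltW b0) (_ : _ <= K)))// ?ler_wpM2r//; lra.
    have : b * K <= d * K by rewrite ler_wpM2r.
    have : b * b <= d * 1 by rewrite ler_pM// ltW.
    have := mulr_ge0 K0 (ltW d_gt0).
    by rewrite mulrN; lra.
  exists a; split=> //.
  (* Undoing the discount adds [b * V y], which is at most [g y + d], hence at most [g x + d] on the
     successors. *)
  have : step V x a <= expR (g x + d) * step (fun y => (1 - b) * V y) x a.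
    apply: step_le => // y /yx gyx; have := Vg y; rewrite ler_norml => /andP[_].
    by lra.
  move=> /le_trans; apply.
  rewrite (le_trans (ler_wpM2l (expR_ge0 _) aV))// -expRD ler_expR.
  lra.
- move=> e e0; pose eta := 1 - expR (- (e / 2)).
  have eta1 : 0 < eta < 1.
    rewrite /eta subr_gt0 expR_lt1 ltrBlDr ltrDl expR_gt0 andbT.
    lra.
  (* [Z] is large enough that a contribution [expR (c x a + V x - Z)] is at most the fraction [eta]
     of [expR (V x - b)]; the bound [gap / (2 * Z)] on [d] makes successors with [g y < g x] that
     small. *)
  pose Z := K + 1 - ln eta.
  have Z0 : 0 < Z by have := ln_lt0 eta1; rewrite /Z; lra.
  pose d := Order.min (Order.min d0 (e / 4)) (gap / (2 * Z)).
  have dd0 : d <= d0 by rewrite ge_min ge_min lexx.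
  have de : d <= e / 4 by rewrite ge_min ?ge_min lexx ?orbT.
  have dZ : d <= gap / (2 * Z) by rewrite ge_min lexx orbT.
  have d_gt0 : 0 < d by rewrite lt_min lt_min d00 !divr_gt0// mulr_gt0.
  have d1 : d <= 1 by rewrite (le_trans dd0)// ge_min lexx.
  have [b [V [b01 bd VK Vg VP]]] := gP _ d_gt0; exists V => t x a xa.
  have /andP[b0 b1] := b01.
  have [+ _] := VP x => /(_ a xa) aV.
  pose U y := V y + t%:R * g y - t.+1%:R * g x.
  (* For g x <= g y the bound holds for every t >= 0, as t.+1 * (g y - g x) >= 0; for g y < g x
     the last term absorbs it. *)
  have WU y : expR ((1 - b) * V y) <= expR (d + U y) + expR (V x - Z).
    have := Vg y; rewrite ler_norml => /andP[k1 k2].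
    have [gxy|/gapP gyx] := leP (g x) (g y).
      rewrite -[leLHS]addr0 lerD ?expR_ge0// ler_expR /U.
      have := mulr_ge0 (ler0n R t.+1) (_ : 0 <= g y - g x).
      by rewrite subr_ge0 -natr1 => /(_ gxy); lra.
    rewrite -[leLHS]add0r lerD ?expR_ge0// ler_expR.
    have := gW _ _ _ y b01 bd (VK y) (Vg y); have := Vg x.
    rewrite !ler_norml => /andP[k3 _] /andP[_ k4].
    have Zd : Z * d <= gap / 2.
      have := dZ; rewrite ler_pdivlMr ?mulr_gt0//; lra.
    have Zb : Z * b <= Z * d by rewrite ler_wpM2l// ltW.
    have := dd0; rewrite le_min => /andP[_]; rewrite ler_pdivlMr// => dC.
    have Kd := mulr_ge0 K0 (ltW d_gt0).
    rewrite -(ler_pM2l b0) mulrBr [b * Z]mulrC.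
    lra.
  have : step (fun y => (1 - b) * V y) x a <=
      expR d * step U x a + expR (c x a + V x - Z).
    rewrite /step mulrCA -addrA expRD -mulrDr ler_wpM2l ?expR_ge0//.
    have -> : expR (V x - Z) = \sum_y trans M x a y * expR (V x - Z).
      by rewrite -mulr_suml trans_sum1// mul1r.
    rewrite mulr_sumr -big_split/=.
    apply: ler_sum => y _.
    by rewrite mulrCA -mulrDr -expRD ler_wpM2l ?trans_ge0.
  move=> /(le_trans aV) h.
  have h2 : expR (c x a + V x - Z) <= eta * expR (V x - b).
    rewrite -[X in X * _]lnK ?posrE; last by case/andP: eta1.
    rewrite -expRD ler_expR /Z.
    by have := cK x a; rewrite ler_norml => /andP[_]; lra.
  (* Moving the fraction [eta] to the left leaves [1 - eta = expR (- (e / 2))]. The total loss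
     [b + d + e / 2] is at most [e], as [b] and [d] are at most [e / 4]. *)
  have h3 : expR (V x - b - e / 2) <= expR d * step U x a.
    rewrite expRD; move: h h2; rewrite /eta mulrBl mul1r [_ * expR (V x - b)]mulrC.
    lra.
  have h4 : step U x a <= expR (- (t.+1%:R * g x)) * step (fun y => V y + t%:R * g y) x a.
    by apply: step_le => // y _; rewrite /U.
  have {h4} := le_trans h3 (ler_wpM2l (expR_ge0 d) h4).
  rewrite mulrA -expRD -(ler_pM2l (expR_gt0 (t.+1%:R * g x - d))) -expRD mulrA -expRD.
  rewrite (_ : t.+1%:R * g x - d + (d - t.+1%:R * g x) = 0); last by ring.
  rewrite expR0 mul1r; apply: le_trans; rewrite ler_expR.
  by lra.
Qed.

End Operator.

(** * Exponential moments of the accumulated cost under the law of a policy *)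

Section Law.
Context {R : realType} {S A : finType} (M : mdp R S A).

(** The event is a finite union, over prefixes of length [N], of finite intersections of cylinders;
    [point] fills the later coordinates. *)
Lemma measurable_finite_prefix (T : finType) (N : nat) (Y : traj M -> T) (v : T) :
  (forall w w', (forall i, (i < N)%N -> w i = w' i) -> Y w = Y w') ->
  measurable [set w | Y w = v].
Proof.
move=> Yext.
have -> : [set w | Y w = v] = \bigcup_(u in [set u : N.-tuple (KK M) |
    Y (nth point u) = v]) \bigcap_(i in `I_N) [set w : traj M | w i = nth point u i].
  have YE (w : traj M) : Y (nth point [tuple w i | i < N]) = Y w.
    apply: Yext => i iN.
    by rewrite -[RHS](tnth_mktuple w (Ordinal iN)) (tnth_nth point).
  apply/seteqP; split=> [w /= wv|w [u /= uv wu]].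
    exists [tuple w i | i < N]; first by rewrite /= YE.
    move=> i /= iN.
    by rewrite -[LHS](tnth_mktuple w (Ordinal iN)) (tnth_nth point).
  by rewrite -uv; exact: Yext.
apply: fin_bigcup_measurable => // u _; apply: bigcap_measurableType => i _.
by apply: sub_sigma_algebra; exists i => //; exists (nth point u i).
Qed.

Lemma expectation_finite (P : probability (traj M) R) (T : finType) (Y : traj M -> T)
    (F : T -> R) :
  (forall v, measurable [set w | Y w = v]) -> (forall v, 0 <= F v) ->
  ('E_P[fun w => F (Y w)] = (\sum_v F v * fine (P [set w | Y w = v]))%R%:E)%E.
Proof.
move=> mY F0; rewrite unlock.
have -> : (fun w => (F (Y w))%:E) =
    (fun w => (\sum_v (F v)%:E * (\1_[set w | Y w = v] w)%:E)%E).
  apply/funext => w; rewrite (bigD1 (Y w))//= big1 => [|v vY].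
    by rewrite indicE mem_set// mule1 adde0.
  rewrite indicE memNset ?mule0// => /= /eqP; rewrite eq_sym.
  exact/negP.
have mI v : measurable_fun setT (EFin \o (\1_[set w | Y w = v] : _ -> R)).
  by apply/measurable_EFinP; exact: measurable_indic.
rewrite ge0_integral_sum//; last 2 first.
- by move=> v; apply: measurable_funeM (mI v).
- by move=> v w _; rewrite mule_ge0// lee_fin// indicE.
rewrite -sumEFin; apply: eq_bigr => v _.
rewrite (ge0_integralZl_EFin P measurableT _ (mI v) (F0 v)); last first.
  by move=> w _; rewrite lee_fin.
by rewrite integral_indic// setIT EFinM fineK// fin_num_measure.
Qed.

Context (c : S -> A -> R) (pi : policy M) (x : S) (P : probability (traj M) R).
Hypothesis PL : is_law pi x P.

Definition path_cost t (k : t.-tuple (KK M)) : R :=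
  \sum_i c (val (tnth k i)).1 (val (tnth k i)).2.

Definition path_weight t (h : t.-tuple (KK M) * S) : R :=
  fine (P [set w | hist_at t w = h]) * expR (path_cost h.1).

(** [u] acts as a terminal cost; for [u = 0] this is the moment inside [J_]. *)
Definition tilted_mean t (u : S -> R) : R :=
  fine 'E_P[fun w => (expR (\sum_(i < t) c (X_ i w) (A_ i w)) * expR (u (X_ t w)))%R]%E.

Lemma path_weight_ge0 t h : 0 <= @path_weight t h.
Proof. by rewrite mulr_ge0 ?expR_ge0// fine_ge0. Qed.

Lemma path_cost_hist t w :
  path_cost (hist_at t w).1 = \sum_(i < t) c (X_ i w) (A_ i w).
Proof. by apply: eq_bigr => i _; rewrite tnth_mktuple. Qed.

Lemma hist_at_ext t (w w' : traj M) :
  (forall i, (i < t.+1)%N -> w i = w' i) -> hist_at t w = hist_at t w'.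
Proof.
move=> ww'; rewrite /hist_at /X_ ww'//; congr (_, _).
by apply: eq_from_tnth => i; rewrite !tnth_mktuple ww'// ltnS ltnW.
Qed.

Lemma tilted_meanE t u :
  tilted_mean t u = \sum_h @path_weight t h * expR (u h.2).
Proof.
rewrite /tilted_mean.
pose F (h : t.-tuple (KK M) * S) := expR (path_cost h.1) * expR (u h.2).
have -> : (fun w => expR (\sum_(i < t) c (X_ i w) (A_ i w)) * expR (u (X_ t w))) =
    (fun w => F (hist_at t w)).
  by apply/funext => w; rewrite /F path_cost_hist.
rewrite (@expectation_finite P _ (hist_at t : _ -> (t.-tuple (KK M) * S)%type) F)/=.
- by apply: eq_bigr => h _; rewrite /F /path_weight; ring.
- by move=> v; apply: measurable_finite_prefix; exact: hist_at_ext.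
- by move=> v; rewrite mulr_ge0 ?expR_ge0.
Qed.

(** The two conditional identities of [is_law] factor out the last action and the last state, so the
    last transition contributes one application of [step]. *)
Lemma tilted_meanS t u :
  tilted_mean t.+1 u =
  \sum_h @path_weight t h * \sum_a pi t h a * step M c u h.2 a.
Proof.
rewrite /tilted_mean.
pose F (q : t.-tuple (KK M) * S * A * S) :=
  expR (path_cost q.1.1.1) * expR (c q.1.1.2 q.1.2) * expR (u q.2).
pose Y (w : traj M) : t.-tuple (KK M) * S * A * S := (hist_at t w, A_ t w, X_ t.+1 w).
have -> : (fun w => expR (\sum_(i < t.+1) c (X_ i w) (A_ i w)) * expR (u (X_ t.+1 w))) =
    (fun w => F (Y w)).
  by apply/funext => w; rewrite /F big_ord_recr/= expRD path_cost_hist.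
rewrite (@expectation_finite P _ Y F)/=; last 2 first.
- move=> v; apply: (@measurable_finite_prefix _ t.+2) => w w' ww'.
  rewrite /Y (@hist_at_ext t w w') => [|i it]; last by rewrite ww'// ltnW.
  by rewrite /A_ /X_ !ww'.
- by move=> v; rewrite !mulr_ge0 ?expR_ge0.
have [_ PA PX] := PL.
have PE h a y : fine (P [set w | Y w = (h, a, y)]) =
    trans M h.2 a y * (pi t h a * fine (P [set w | hist_at t w = h])).
  have -> : [set w | Y w = (h, a, y)] =
      [set w | [/\ hist_at t w = h, A_ t w = a & X_ t.+1 w = y]].
    by apply/seteqP; split=> w /= [<- <- <-].
  have mh : measurable [set w | hist_at t w = h].
    by apply: (@measurable_finite_prefix (t.-tuple (KK M) * S)%type); exact: hist_at_ext.
  by rewrite PX PA -(fineK (fin_num_measure P _ mh)).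
transitivity (\sum_h \sum_a \sum_y F (h, a, y) * fine (P [set w | Y w = (h, a, y)])).
  by rewrite !pair_bigA/=; apply: eq_bigr => -[[h a] y].
apply: eq_bigr => h _; rewrite mulr_sumr; apply: eq_bigr => a _.
rewrite /step !mulr_sumr; apply: eq_bigr => y _.
by rewrite PE /F /path_weight /=; ring.
Qed.

Lemma tilted_mean0 u : tilted_mean 0 u = expR (u x).
Proof.
rewrite /tilted_mean.
have -> : (fun w => expR (\sum_(i < 0) c (X_ i w) (A_ i w)) * expR (u (X_ 0 w))) =
    (fun w : traj M => expR (u (X_ 0 w))).
  by apply/funext => w; rewrite big_ord0 expR0 mul1r.
have mX y : measurable [set w : traj M | X_ 0 w = y].
  by apply: (@measurable_finite_prefix _ 1) => w w' ww'; rewrite /X_ ww'.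
rewrite (@expectation_finite P _ (X_ 0) (fun y => expR (u y)))//=.
have [P0 _ _] := PL.
rewrite (bigD1 x)//= big1 => [|y yx]; first by rewrite P0 /= mulr1 addr0.
suff -> : P [set w | X_ 0 w = y] = 0%E by rewrite /= mulr0.
apply/eqP; rewrite eq_le measure_ge0 andbT.
rewrite -[leRHS](_ : P (~` [set w | X_ 0 w = x]) = 0%E); last first.
  by rewrite probability_setC// P0 subee.
apply: le_measure; rewrite ?inE//; first exact: measurableC.
by move=> w /= -> /eqP; rewrite (negbTE yx).
Qed.

Lemma le_tilted_mean t u v : (forall y, u y <= v y) -> tilted_mean t u <= tilted_mean t v.
Proof.
move=> uv; rewrite !tilted_meanE; apply: ler_sum => h _.
by rewrite ler_wpM2l ?path_weight_ge0// ler_expR.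
Qed.

Lemma tilted_meanD t u d : tilted_mean t (fun y => u y + d) = expR d * tilted_mean t u.
Proof.
by rewrite !tilted_meanE mulr_sumr; apply: eq_bigr => h _; rewrite expRD; ring.
Qed.

(** [u k] is a value with [k] steps left. By [tilted_meanS], going from time [t] with [n.+1] steps
    left to time [t.+1] with [n] left cannot decrease the mean. *)
Lemma tilted_mean_ge (u : nat -> S -> R) n :
  (forall k y a, a \in adm M y -> expR (u k.+1 y) <= step M c (u k) y a) ->
  expR (u n x) <= tilted_mean n (u 0).
Proof.
move=> uS; rewrite -tilted_mean0 -[X in tilted_mean X (u 0)]add0n.
elim: n 0%N => [|n IH] t; first by rewrite addn0.
rewrite -addSnnS; apply: le_trans (IH t.+1).
rewrite tilted_meanE tilted_meanS; apply: ler_sum => h _.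
rewrite ler_wpM2l ?path_weight_ge0// -[leLHS]mul1r -(pol_sum1 pi h) mulr_suml.
apply: ler_sum => a _; have [ha|/pol_adm ->] := boolP (a \in adm M h.2).
  by rewrite ler_wpM2l ?pol_ge0// uS.
by rewrite !mul0r.
Qed.

Lemma tilted_mean_le (u : nat -> S -> R) (f : selector M) n : pi = stationary f ->
  (forall k y, step M c (u k) y (sval f y) <= expR (u k.+1 y)) ->
  tilted_mean n (u 0) <= expR (u n x).
Proof.
move=> pif uS; rewrite -tilted_mean0 -[X in tilted_mean X (u 0)]add0n.
elim: n 0%N => [|n IH] t; first by rewrite addn0.
rewrite -addSnnS; apply: le_trans (IH t.+1) _.
rewrite tilted_meanS tilted_meanE; apply: ler_sum => h _.
rewrite ler_wpM2l ?path_weight_ge0// pif/= (bigD1 (sval f h.2))//= eqxx mul1r.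
by rewrite big1 ?addr0// => a /negPf ->; rewrite mul0r.
Qed.

End Law.

(** * Limits superior of sequences known up to an error of order 1/n *)

Section LimitSuperior.
Context {R : realType}.

Lemma eventually_div_le (K e : R) : 0 < e ->
  exists N, forall n, (N <= n)%N -> (0 < n)%N /\ K / n%:R <= e.
Proof.
move=> e0; exists (Num.bound (`|K| / e)).+1 => n Nn; split; first exact: leq_ltn_trans Nn.
have n0 : 0 < n%:R :> R by rewrite ltr0n (leq_ltn_trans _ Nn).
rewrite ler_pdivrMr// mulrC -ler_pdivrMr//.
apply: le_trans (_ : `|K| / e <= _); first by rewrite ler_pM2r ?invr_gt0// ler_norm.
rewrite (le_trans (ltW (archi_boundP _)))// ?divr_ge0// ?(ltW e0)//.
by rewrite ler_nat ltnW.
Qed.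

Lemma limn_esup_ge_rate (u : nat -> R) (l K : R) :
  (forall n, (0 < n)%N -> l - K / n%:R <= u n) ->
  (l%:E <= limn_esup (fun n => (u n)%:E))%E.
Proof.
move=> lu; apply/lee_addgt0Pr => e e0; have [N NP] := eventually_div_le K e0.
rewrite -leeBlDr//; apply: le_ereal_inf_tmp => _ [V [m _ mV] <-].
have [n0 Kn] := NP _ (leq_maxr m N).
apply: le_trans (ereal_sup_ubound _); last by exists (maxn m N) => //; apply: mV; exact: leq_maxl.
by rewrite -EFinB lee_fin (le_trans _ (lu _ n0))// lerB.
Qed.

Lemma limn_esup_le_rate (u : nat -> R) (l K : R) :
  (forall n, (0 < n)%N -> u n <= l + K / n%:R) ->
  (limn_esup (fun n => (u n)%:E) <= l%:E)%E.
Proof.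
move=> ul; apply/lee_addgt0Pr => e e0; have [N NP] := eventually_div_le K e0.
apply: ge_ereal_inf; exists (ereal_sup [set (u n)%:E | n in [set n | (N <= n)%N]]).
  by exists [set n | (N <= n)%N] => //; exists N.
apply: ge_ereal_sup => _ [n /= /NP[n0 Kn] <-].
by rewrite -EFinD lee_fin (le_trans (ul _ n0))// lerD2l.
Qed.

End LimitSuperior.

(** * From one-step inequalities to bounds on the average cost *)

Section Bounds.
Context {R : realType} {S A : finType} (M : mdp R S A) (lam : R).
Hypothesis lam0 : 0 < lam.
Local Notation c := (fun x a => lam * cost M x a).

Lemma J_tilted_mean (pi : policy M) x n :
  J_ lam pi x n = lam^-1 * ln (tilted_mean c (process_law pi x) n (fun=> 0)).
Proof.
rewrite /J_ /tilted_mean; congr (_ * ln (fine (expectation _ _))).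
by apply/funext => w; rewrite expR0 mulr1 mulr_sumr.
Qed.

(** Replacing the terminal cost [u 0] by 0 costs a factor [expR K], so the logarithm of the moment
    is at least [r * n - 2 * K], and the constant disappears after division by [n]. *)
Lemma J_ge (pi : policy M) x (u : nat -> S -> R) (r K : R) :
  (forall k y a, a \in adm M y -> expR (u k.+1 y) <= step M c (u k) y a) ->
  (forall y, u 0%N y <= K) -> (forall n, r * n%:R - K <= u n x) ->
  ((r / lam)%:E <= J lam pi x)%E.
Proof.
move=> uS uK ur; apply: (@limn_esup_ge_rate _ _ _ (2 * K / lam)) => n n0.
rewrite J_tilted_mean.
have h : expR (u n x - K) <= tilted_mean c (process_law pi x) n (fun=> 0).
  rewrite expRD mulrC -ler_pdivlMl ?expR_gt0// expRN invrK -tilted_meanD.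
  apply: le_trans (tilted_mean_ge (process_lawP pi x) n uS) _.
  by apply: le_tilted_mean => y; rewrite add0r.
have n0' : 0 < n%:R :> R by rewrite ltr0n.
have : r * n%:R - 2 * K <= ln (tilted_mean c (process_law pi x) n (fun=> 0)).
  rewrite -ler_expR lnK; last by rewrite posrE (lt_le_trans (expR_gt0 _) h).
  by apply: le_trans h; rewrite ler_expR; have := ur n; lra.
move=> /(ler_wpM2l (_ : 0 <= n%:R^-1 * lam^-1)) h2.
rewrite mulrA (le_trans _ (h2 _))//; last by rewrite mulr_ge0// invr_ge0 ltW.
rewrite le_eqVlt; apply/orP; left; apply/eqP; field.
by rewrite !gt_eqF.
Qed.

Lemma J_le (f : selector M) x (u : nat -> S -> R) (r K : R) :
  (forall k y, step M c (u k) y (sval f y) <= expR (u k.+1 y)) ->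
  (forall y, - K <= u 0%N y) -> (forall n, u n x <= r * n%:R + K) ->
  (J lam (stationary f) x <= (r / lam)%:E)%E.
Proof.
move=> uS uK ur; apply: (@limn_esup_le_rate _ _ _ (2 * K / lam)) => n n0.
rewrite J_tilted_mean; set m := tilted_mean _ _ _ _.
have h : m <= expR (u n x + K).
  rewrite expRD mulrC -ler_pdivrMl ?expR_gt0// -expRN -tilted_meanD.
  apply: le_trans (tilted_mean_le (process_lawP _ x) n erefl uS).
  by apply: le_tilted_mean => y; rewrite add0r.
(* Positivity is needed to invert [ln]; it comes from the lower bound [- K'] on every one-step
   cost. *)
have m0 : 0 < m.
  have [K' _ K'P] := finite_bound (fun xa : S * A => c xa.1 xa.2).
  pose v k (_ : S) := - (k%:R * K').
  apply: lt_le_trans (expR_gt0 (v n x)) _.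
  have -> : m = tilted_mean c (process_law (stationary f) x) n (v 0%N).
    by congr tilted_mean; apply/funext => y; rewrite /v mul0r oppr0.
  apply: (tilted_mean_ge (u := v) (process_lawP (stationary f) x)) => k y a ya.
  rewrite /step /v -mulr_suml trans_sum1// mul1r -expRD ler_expR.
  by have := K'P (y, a); rewrite ler_norml -natr1 /= => /andP[? _]; lra.
have n0' : 0 < n%:R :> R by rewrite ltr0n.
have : ln m <= r * n%:R + 2 * K.
  rewrite -ler_expR lnK//.
  by apply: le_trans h _; rewrite ler_expR; have := ur n; lra.
move=> /(ler_wpM2l (_ : 0 <= n%:R^-1 * lam^-1)) h2.
rewrite mulrA (le_trans (h2 _))//; first by rewrite mulr_ge0// invr_ge0 ltW.
rewrite le_eqVlt; apply/orP; left; apply/eqP; field.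
by rewrite !gt_eqF.
Qed.

(** A minimizing action in [B_ g] never leads to a larger value of [g], so adding multiples of [g]
    to [h] preserves the one-step inequality, and [g] bounds the growth rate. *)
Lemma J_le_GG (g : S -> R) x : GG M lam g ->
  exists f : selector M, (J lam (stationary f) x <= (g x)%:E)%E.
Proof.
move=> [_ [h hP]].
have /choice[f fP] : forall x, exists a, [/\ a \in adm M x,
    forall y, 0 < trans M x a y -> g y <= g x &
    step M c (fun y => lam * h y) x a <= expR (lam * g x + lam * h x)].
  (* If no action worked, every term of the minimum and its default [+oo] would exceed the real
     bound in [hP]; this also excludes an empty [B_ g y]. *)
  move=> y; apply: contrapT => nex.
  have := hP y; rewrite leNgt => /negP; apply; apply/bigmin_gtP.
  split=> [|a]; first exact: ltry.
  rewrite inE => /andP[ya /eqP gE]; rewrite lte_fin ltNge; apply/negP => le_a.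
  apply: nex; exists a; split=> // z yz; rewrite -lee_fin gE.
  exact: (@le_bigmax_cond _ _ _ _ z).
have fadm y : f y \in adm M y by have [] := fP y.
exists (exist _ f fadm).
have [K K0 KP] := finite_bound (fun y => lam * h y).
rewrite -[g x](mulfK (negbT (gt_eqF lam0))).
apply: (@J_le _ _ (fun k y => lam * h y + k%:R * (lam * g y)) _ K) => [k y|y|n].
- have [ya gy sy] := fP y.
  have /le_trans : step M c (fun y => lam * h y + k%:R * (lam * g y)) y (f y) <=
      expR (k%:R * (lam * g y)) * step M c (fun y => lam * h y) y (f y).
    apply: step_le => // z /gy gz; rewrite lerD2l ler_wpM2l// ler_wpM2l//.
    exact: ltW.
  apply; rewrite (le_trans (ler_wpM2l (expR_ge0 _) sy))// -expRD ler_expR -natr1.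
  lra.
- by have := KP y; rewrite ler_norml mul0r addr0 => /andP[].
- by have := KP x; rewrite ler_norml => /andP[_ ?]; lra.
Qed.

End Bounds.

Theorem theorem3p5 (R : realType) (S A : finType) (M : mdp R S A)
    (lam : R) (hlam : 0 < lam) (hM : doeblin M) (x : S) :
  Jopt M lam x = ereal_inf [set (g x)%:E | g in GG M lam].
Proof.
have [g [gi gii giii]] := growth_rate M (fun x a => lam * cost M x a).
have lam0 : lam != 0 by rewrite gt_eqF.
have Jge : ((g x / lam)%:E <= Jopt M lam x)%E.
  apply: le_ereal_inf_tmp => _ [pi _ <-]; apply/lee_addgt0Pr => e e0.
  have [h hP] := giii (lam * e) (mulr_gt0 hlam e0).
  have [K K0 KP] := finite_bound h.
  rewrite -leeBlDr// -EFinB.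
  have -> : g x / lam - e = (g x - lam * e) / lam by field.
  (* The one-step inequality loses [lam * e] each time; subtracting the accumulated loss makes it
     exact and lowers the rate to [g x - lam * e]. *)
  apply: (@J_ge _ _ _ _ _ hlam pi x (fun k y => h y + k%:R * g y - k%:R * (lam * e)) _ K).
  - move=> k y a ya.
    apply: (@le_trans _ _ (expR (- (k%:R * (lam * e))) *
        step M (fun x a => lam * cost M x a) (fun z => h z + k%:R * g z) y a)).
      apply: le_trans (ler_wpM2l (expR_ge0 _) (hP k y a ya)).
      by rewrite -expRD ler_expR -natr1; lra.
    rewrite expRN ler_pdivrMl ?expR_gt0//.
    by apply: step_le => // z _; rewrite subrK.
  - by move=> y; have := KP y; rewrite ler_norml !mul0r subr0 addr0 => /andP[].
  - by move=> n; have := KP x; rewrite ler_norml => /andP[? _]; lra.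
apply/le_anti/andP; split.
  apply: le_ereal_inf_tmp => _ [g' g'G <-]; have [f] := J_le_GG hlam x g'G.
  by apply: le_trans; apply: ereal_inf_lbound; exists (stationary f).
apply: le_trans Jge; apply/lee_addgt0Pr => e e0; apply: ereal_inf_lbound.
(* The shift by [e] absorbs the error [lam * e] of [gii], and [g'] orders the states as [g] does, so
   the min-max equation carries over. *)
pose g' y := g y / lam + e.
have g'le y z : (g' y <= g' z) = (g y <= g z).
  by rewrite lerD2r ler_pM2r// invr_gt0.
exists g' => //; have [h hP] := gii (lam * e) (mulr_gt0 hlam e0).
have geM y a : a \in adm M y -> ((g' y)%:E <= succ_max M g' y a)%E.
  move=> /gi[z yz gyz]; apply: (bigmax_sup z) => //.
  by rewrite lee_fin g'le.
have leM y a : (forall z, 0 < trans M y a z -> g z <= g y) ->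
    (succ_max M g' y a <= (g' y)%:E)%E.
  move=> gy; apply/bigmax_leP; split=> [|z yz]; first exact: leNye.
  by rewrite lee_fin g'le gy.
split=> [y|].
  (* Every admissible action has a successor at least as high as [y], and the action from [gii] has
     none higher, so the minimum equals [g' y]. *)
  have [a [ya gy _]] := hP y; apply/le_anti/andP; split.
    by apply/bigmin_geP; split=> [|b]; [exact: leey|exact: geM].
  by apply: (bigmin_inf a) => //; exact: leM.
exists (fun y => h y / lam) => y; have [a [ya gy sy]] := hP y.
apply: (bigmin_inf a).
  by rewrite inE ya/= eq_le geM//= leM.
rewrite lee_fin; under eq_bigr => z _ do rewrite [X in expR X]mulrC divfK//.
move: sy; rewrite /step => /le_trans; apply.
suff -> : lam * g' y + lam * (h y / lam) = g y + lam * e + h y by [].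
by rewrite /g'; field.
Qed.
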